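(* Consider the averaged DC/AC converter $$C_{dc}\dot v_{dc}=-G_{dc}v_{dc}+i_{dc}-\tfrac12 m_{\alpha\beta}^\top i_{\alpha\beta},\qquad L\,\dot i_{\alpha\beta}=-R\,i_{\alpha\beta}+\tfrac12 m_{\alpha\beta}v_{dc}-v_{\alpha\beta},\qquad C\,\dot v_{\alpha\beta}=-i_{load}+i_{\alpha\beta}$$ in closed loop with the matching control $$\dot\theta_v=\eta\,v_{dc},\qquad m_{\alpha\beta}=\mu\begin{bmatrix}-\sin\theta_v\\ \cos\theta_v\end{bmatrix},$$ where $\eta>0$ and $\mu\in(0,1]$ are constants. Put $\omega_v=\eta v_{dc}$. Then $(\theta_v,\omega_v,v_{\alpha\beta},i_{\alpha\beta})$ satisfies the synchronous machine equations $$\dot\theta=\omega,\quad M\dot\omega=-D\omega+\tau_m+i_{\alpha\beta}^\top L_m i_f\begin{bmatrix}-\sin\theta\\ \cos\theta\end{bmatrix},\quad C\dot v_{\alpha\beta}=-i_{load}+i_{\alpha\beta},\quad L_s\dot i_{\alpha\beta}=-R\,i_{\alpha\beta}-v_{\alpha\beta}-\omega L_m i_f\begin{bmatrix}-\sin\theta\\ \cos\theta\end{bmatrix}$$ with $\theta=\theta_v$, $\omega=\omega_v$ and parameters $M=C_{dc}/\eta^2$, $D=G_{dc}/\eta^2$, $\tau_m=i_{dc}/\eta$, $L_s=L$, and $L_m i_f=-\mu/(2\eta)$.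
   Context: $v_{dc}(t)\in\mathbb R$ is the DC capacitor voltage, $i_{\alpha\beta}(t)\in\mathbb R^2$ the inductor current, $v_{\alpha\beta}(t)\in\mathbb R^2$ the AC capacitor voltage, $i_{load}(t)\in\mathbb R^2$ the load current, and $i_{dc}>0$ the constant DC source current. The constants $C_{dc},G_{dc},C,L,R$ are positive. In the synchronous machine, $\theta$ is the rotor angle, $\omega$ the rotor angular velocity, $M$ the inertia, $D$ the damping, $\tau_m$ the mechanical torque, $L_m$ the stator-to-rotor mutual inductance, $i_f$ the (externally regulated, constant) rotor field current, $L_s$ the stator inductance, and $R$ the stator resistance; $C$ is the terminal shunt capacitance. *)

(* Defs.v *)
From HB Require Import structures.
From mathcomp Require Import all_boot all_order all_algebra.
From mathcomp Require Import all_classical all_reals all_analysis.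

Set Implicit Arguments.
Unset Strict Implicit.
Unset Printing Implicit Defensive.

Import Order.TTheory GRing.Theory Num.Theory.
Import numFieldNormedType.Exports.

Local Open Scope classical_set_scope.
Local Open Scope ring_scope.

(* Signals are total functions of time, and the equations are imposed at the
   times of a set T only.  Since derive1 has a junk value where a function is
   not differentiable, differentiability of the state is part of being a
   solution of each of the systems below. *)

Definition quad_vec (R : realType) (theta : R) : 'cV[R]_2 :=
  \col_(k < 2) (if k == 0 then - sin theta else cos theta).

Definition dotv (R : realType) (u v : 'cV[R]_2) : R := (u^T *m v) 0 0.

Definition averaged_converter (R : realType) (T : set R)
    (Cdc Gdc C L r idc : R) (mab iload : R -> 'cV[R]_2)
    (vdc : R -> R) (iab vab : R -> 'cV[R]_2) : Prop :=
  forall t : R, T t ->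
    [/\ derivable vdc t 1, derivable iab t 1 & derivable vab t 1] /\
    [/\ Cdc * derive1 vdc t = - (Gdc * vdc t) + idc - 2^-1 * dotv (mab t) (iab t),
        L *: derive1 iab t = - (r *: iab t) + 2^-1 *: (vdc t *: mab t) - vab t
      & C *: derive1 vab t = - iload t + iab t].

Definition matching_control (R : realType) (T : set R) (eta mu : R)
    (vdc : R -> R) (thetav : R -> R) (mab : R -> 'cV[R]_2) : Prop :=
  forall t : R, T t ->
    [/\ derivable thetav t 1,
        derive1 thetav t = eta * vdc t
      & mab t = mu *: quad_vec (thetav t)].

Definition synchronous_machine (R : realType) (T : set R)
    (M D taum Lm i_f C Ls r : R) (iload : R -> 'cV[R]_2)
    (theta omega : R -> R) (vab iab : R -> 'cV[R]_2) : Prop :=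
  forall t : R, T t ->
    [/\ derivable theta t 1, derivable omega t 1,
        derivable vab t 1 & derivable iab t 1] /\
    [/\ derive1 theta t = omega t,
        M * derive1 omega t = - (D * omega t) + taum
          + dotv (iab t) ((Lm * i_f) *: quad_vec (theta t)),
        C *: derive1 vab t = - iload t + iab t
      & Ls *: derive1 iab t = - (r *: iab t) - vab t
          - (omega t * (Lm * i_f)) *: quad_vec (theta t)].

(* Main.v *)
Require Import Defs.
From HB Require Import structures.
From mathcomp Require Import all_boot all_order all_algebra.
From mathcomp Require Import all_classical all_reals all_analysis.
From mathcomp Require Import ring.

(** The matching control makes the DC voltage play the part of a rotor speed:
since [omega = eta * vdc] is a constant multiple of [vdc], the rotor angle
equation is the controller itself.  Dividing the DC-side charge balance by
[eta] gives the swing equation, since [Cdc * vdc' / eta = (Cdc / eta ^+ 2) * omega'],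
and similarly for the losses and the source current.  The modulation acts on
both sides of the converter through the same vector [mab / 2], which is
[mu / 2 *: quad_vec thetav].  As [mu / 2 = - eta * (Lm * i_f)], the bridge
current [1 / 2 * dotv mab iab], divided by [- eta], is the electrical torque
([dotvC] and [dotvZr] put it in that form), and the bridge voltage
[1 / 2 *: (vdc *: mab)] is the electromotive force
[- (omega * (Lm * i_f)) *: quad_vec thetav]. *)

Set Implicit Arguments.
Unset Strict Implicit.
Unset Printing Implicit Defensive.

Import Order.TTheory GRing.Theory Num.Theory.
Import numFieldNormedType.Exports.

Local Open Scope classical_set_scope.
Local Open Scope ring_scope.

Lemma dotvC (R : realType) (u v : 'cV[R]_2) : dotv u v = dotv v u.
Proof. by rewrite /dotv -[v in LHS]trmxK -trmx_mul mxE. Qed.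

Lemma dotvZr (R : realType) (a : R) (u v : 'cV[R]_2) :
  dotv u (a *: v) = a * dotv u v.
Proof. by rewrite /dotv -scalemxAr mxE. Qed.

Theorem mainTheorem1 (R : realType) (T : set R)
    (openT : open T) (intervalT : is_interval T)
    (Cdc Gdc C L r idc eta mu : R)
    (Cdc_gt0 : 0 < Cdc) (Gdc_gt0 : 0 < Gdc) (C_gt0 : 0 < C) (L_gt0 : 0 < L)
    (r_gt0 : 0 < r) (idc_gt0 : 0 < idc)
    (eta_gt0 : 0 < eta) (mu_gt0 : 0 < mu) (mu_le1 : mu <= 1)
    (iload : R -> 'cV[R]_2) (vdc : R -> R) (iab vab : R -> 'cV[R]_2)
    (thetav : R -> R) (mab : R -> 'cV[R]_2)
    (converter : averaged_converter T Cdc Gdc C L r idc mab iload vdc iab vab)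
    (control : matching_control T eta mu vdc thetav mab)
    (M D taum Ls Lm i_f : R)
    (ME : M = Cdc / eta ^+ 2) (DE : D = Gdc / eta ^+ 2)
    (taumE : taum = idc / eta) (LsE : Ls = L)
    (LmifE : Lm * i_f = - (mu / (2 * eta))) :
  synchronous_machine T M D taum Lm i_f C Ls r iload
    thetav (fun t => eta * vdc t) vab iab.
Proof.
have eta_neq0 : eta != 0 by rewrite gt_eqF.
move=> t Tt.
have [[dvdc diab dvab] [vdcE iabE vabE]] := converter _ Tt.
have [dthetav thetavE mabE] := control _ Tt.
split; split=> //.
- exact: derivableM.
- rewrite derive1Ml// dotvZr LmifE ME DE taumE.
  rewrite mabE dotvC dotvZr in vdcE.
  (* The charge balance divided by eta is the torque balance. *)
  have -> : Cdc / eta ^+ 2 * (eta * derive1 vdc t) = Cdc * derive1 vdc t / eta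
    by field.
  by rewrite vdcE; field.
- rewrite LsE iabE LmifE mabE addrAC; congr (_ + _).
  by rewrite -scaleNr !scalerA; congr (_ *: _); field.
Qed.
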